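(* Let $\Psi'$, $\Psi$ and $F_N$ be Lipschitz continuous with Lipschitz constants $L_{\Psi'}$, $L_\Psi$, $L_{F_N}$. Assume that $\Psi'$ is differentiable, that its Jacobian $J_{\Psi'}$ is Lipschitz continuous with constant $L_{J_{\Psi'}}$ and bounded, $M_{J_{\Psi'}}=\sup_{u_N\in\mathcal M}\|J_{\Psi'}(u_N)\|<\infty$, and that $F_N$ is bounded, $M_{F_N}=\sup_{u_N\in\mathcal M}\|F_N(u_N)\|<\infty$. Then the reduced problem $$u_N=\Psi(u_n),\qquad \dot u_n=F_n(u_n),\qquad u_n(0)=\Psi'(u_{N0})$$ is well-posed.
   Context: $\mathcal P\subset\mathbb R^{a-1}$ is compact with non-empty interior, $T>0$. For $\mu\in\mathcal P$ the $N$-ODE is $\dot u_N=F_N(u_N;\mu)$ on $(0,T]$, $u_N(0)=u_{N0}(\mu)$, in $\mathbb R^N$ (dependence on $\mu$ is usually omitted), and $\mathcal M=\{u_N(t;\mu):t\in[0,T],\mu\in\mathcal P\}$. The encoder $\Psi':\mathbb R^N\to\mathbb R^n$ and decoder $\Psi:\mathbb R^n\to\mathbb R^N$, $n<N$, satisfy $\Psi\circ\Psi'=\mathrm{Id}_{\mathcal M}$ on $\mathcal M$. The reduced right-hand side is $F_n(u_n)=J_{\Psi'}(\Psi(u_n))F_N(\Psi(u_n))$. Well-posed means that the solution exists, is unique, and is stable in the sense of Lyapunov on bounded time intervals: bounded perturbations of the initial condition and of the right-hand side produce a discrepancy in the solution bounded by a constant times the size of the perturbations. *)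

(* Defs.v *)
(* MathComp-Analysis *)
From HB Require Import structures.
From mathcomp Require Import all_boot all_order all_algebra.
From mathcomp Require Import all_classical all_reals all_analysis.

Set Implicit Arguments.
Unset Strict Implicit.
Unset Printing Implicit Defensive.

Import Order.TTheory GRing.Theory Num.Theory.
Import numFieldNormedType.Exports.

Local Open Scope classical_set_scope.
Local Open Scope ring_scope.

(* Vectors of R^m are row vectors 'rV[R]_m, with the library (maximum) norm. *)

(* [u] solves u'(t) = f t (u t) for 0 < t <= T, u(0) = x0. The difference
   quotient is taken along points of [0, T], so the derivative is two-sided at
   interior times and left-sided at T; values of [u] outside [0, T] are
   irrelevant. *)
Definition ivp_solution (R : realType) (m : nat) (T : R)
    (f : R -> 'rV[R]_m -> 'rV[R]_m) (x0 : 'rV[R]_m) (u : R -> 'rV[R]_m) : Prop :=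
  [/\ u 0 = x0,
      {within `[0, T], continuous u}
    & forall t, 0 < t <= T ->
        (s - t)^-1 *: (u s - u t) @[s --> within `[0, T] t^'] --> f t (u t)].

Definition solution_manifold (R : realType) (p N : nat) (P : set 'rV[R]_p)
    (T : R) (F : 'rV[R]_N -> 'rV[R]_p -> 'rV[R]_N) (u0 : 'rV[R]_p -> 'rV[R]_N) :
    set 'rV[R]_N :=
  [set v | exists mu u t, [/\ P mu, ivp_solution T (fun _ x => F x mu) (u0 mu) u,
                              0 <= t <= T & v = u t]].

(* 'J acts on row vectors from the right (it is the transpose of the usual
   Jacobian matrix), so the Jacobian applied to F(Psi x) is written as below. *)
Definition reduced_rhs (R : realType) (N n : nat) (Psi' : 'rV[R]_N -> 'rV[R]_n)
    (Psi : 'rV[R]_n -> 'rV[R]_N) (F : 'rV[R]_N -> 'rV[R]_N) (x : 'rV[R]_n) :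
    'rV[R]_n :=
  F (Psi x) *m 'J Psi' (Psi x).

(* The unknown is the pair (uN, un): uN = Psi(un), un' = f(t, un), un(0) = x0. *)
Definition reduced_solution (R : realType) (N n : nat) (T : R)
    (Psi : 'rV[R]_n -> 'rV[R]_N) (f : R -> 'rV[R]_n -> 'rV[R]_n) (x0 : 'rV[R]_n)
    (uN : R -> 'rV[R]_N) (un : R -> 'rV[R]_n) : Prop :=
  (forall t, 0 <= t <= T -> uN t = Psi (un t)) /\ ivp_solution T f x0 un.

(* Existence, uniqueness and Lyapunov stability on [0, T]. The perturbation
   [d] of the right-hand side is any bounded function of time, not necessarily
   continuous; state-dependent perturbations g(t, z) are covered by taking
   d(t) = g(t, z(t)). The constant [C] does not depend on the perturbation. *)
Definition well_posed (R : realType) (N n : nat) (T : R)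
    (Psi : 'rV[R]_n -> 'rV[R]_N) (Fn : 'rV[R]_n -> 'rV[R]_n) (x0 : 'rV[R]_n) :
    Prop :=
  let solution := reduced_solution T Psi (fun _ => Fn) x0 in
  [/\ exists uN un, solution uN un,
      forall uN un vN vn, solution uN un -> solution vN vn ->
        forall t, 0 <= t <= T -> uN t = vN t /\ un t = vn t
    & exists2 C : R, 0 < C &
        forall uN un, solution uN un ->
        forall (eps : R) (d0 : 'rV[R]_n) (d : R -> 'rV[R]_n) zN zn,
          `|d0| <= eps -> (forall t, 0 <= t <= T -> `|d t| <= eps) ->
          reduced_solution T Psi (fun t x => Fn x + d t) (x0 + d0) zN zn ->
        forall t, 0 <= t <= T ->
          `|zN t - uN t| <= C * eps /\ `|zn t - un t| <= C * eps].

(* Main.v *)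
Require Import Defs.
From HB Require Import structures.
From mathcomp Require Import all_boot all_order all_algebra.
From mathcomp Require Import all_classical all_reals all_analysis.
From mathcomp Require Import ring lra.

Set Implicit Arguments.
Unset Strict Implicit.
Unset Printing Implicit Defensive.

Import Order.TTheory GRing.Theory Num.Theory.
Import numFieldNormedType.Exports.

Local Open Scope classical_set_scope.
Local Open Scope ring_scope.

(** The reduced problem is driven by the full one: if w solves the N-ODE for
    the parameter mu, then Psi' o w solves the reduced ODE, because w stays in
    the solution manifold, where Psi o Psi' is the identity, and the chain rule
    gives (Psi' o w)' = J_Psi'(w) F_N(w) = F_n(Psi' o w). So existence comes
    from the Picard-Lindeloef theorem for the globally Lipschitz field F_N
    (picard_lindelof), although F_n itself need not be globally Lipschitz.

    Uniqueness and stability come from comparing any exact or perturbed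
    solution z with this particular solution u = Psi' o w. In the splitting
      F_n(x) - F_n(y) = J(Psi x) (F_N(Psi x) - F_N(Psi y))
                        + (J(Psi x) - J(Psi y)) F_N(Psi y)
    the factor J(Psi x) is bounded at every x by the Lipschitz constant of
    Psi', and F_N(Psi y) is bounded as soon as Psi y lies in the solution
    manifold. Hence F_n satisfies a Lipschitz estimate for all x when y is on
    the trajectory of u (reduced_rhs_lipschitz_at), which is all that a
    Gronwall argument between z and u uses (ivp_stability). With no
    perturbation it shows that u is the only solution; with perturbations of
    size eps it gives the stability bound, with a constant independent of eps.

    The perturbation of the right-hand side is an arbitrary bounded function of
    time, so z - u need not be the integral of its derivative. Gronwall's
    inequality is therefore proved by maximizing exp(- al t) |e(t)| and looking
    at difference quotients at the maximum (weighted_gronwall). The same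
    inequality, with K = 0, is the contraction estimate of Picard's iteration in
    the norm weighted by exp(- 2 L t). *)

(** * A Gronwall inequality for difference quotients *)

(** The quotients of [ivp_solution] approach t from both sides at interior
    times and from the left at T; the left-hand limit is common to both. *)
Lemma within_itv_at_left (R : realType) (T t : R) : 0 < t <= T ->
  forall A, (within `[0, T] t^') A -> (t^'-) A.
Proof.
move=> /andP[t0 tT] A tA.
have t_gt0 : \forall s \near t, 0 < s by exact: lt_nbhsr.
rewrite /at_left /within /=.
near=> s => /= st.
have : s != t -> s \in `[0, T]%R -> A s by near: s.
apply; first by rewrite lt_eqF.
rewrite in_itv/= (le_trans (ltW st) tT) andbT ltW//.
by near: s.
Unshelve. all: by end_near. Qed.

(** At a point c > 0 where exp(- al t) |e(t)| is maximal, |e| grows to the left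
    of c at least as fast as exp(al t), so al |e(c)| <= |e'(c)|. The assumed
    bound on |e'(c)| then leaves room only for |e(c)| <= D exp(al c). The term
    (al - K) D exp(al t) is exactly what the bound D exp(al t) tolerates, so
    that one statement covers both a constant forcing and the weighted
    contraction of Picard's iteration. *)
Lemma weighted_gronwall (R : realType) (V : normedModType R) (T K al D : R)
    (e e' : R -> V) : 0 <= K < al ->
    {within `[0, T], continuous e} ->
    (forall t, 0 < t <= T ->
       (s - t)^-1 *: (e s - e t) @[s --> within `[0, T] t^'] --> e' t) ->
    `|e 0| <= D ->
    (forall t, 0 < t <= T ->
       `|e' t| <= K * `|e t| + (al - K) * D * expR (al * t)) ->
  forall t, 0 <= t <= T -> `|e t| <= D * expR (al * t).
Proof.
move=> /andP[K0 Kal] ce de e0 e'le t tT.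
have al0 : 0 < al by exact: le_lt_trans Kal.
have T0 : 0 <= T by have /andP[/le_trans] := tT; apply.
pose h s := expR (- (al * s)) * `|e s|.
have ch : {within `[0, T], continuous h}.
  move=> s; apply: cvgM; last by apply: cvg_norm; exact: ce.
  apply: (@continuous_subspaceT _ _ `[0, T] (fun s => expR (- (al * s)))) => u.
  apply: continuous_comp; last exact: continuous_expR.
  by apply: cvgN; apply: cvgMr; exact: cvg_id.
have [c] := EVT_max T0 ch; rewrite in_itv/= => /andP[c0 cT] hmax.
suff hcD : h c <= D.
  have := le_trans (hmax t tT) hcD.
  by rewrite /h expRN mulrC ler_pdivrMr ?expR_gt0.
have [->|c_neq0] := eqVneq c 0; first by rewrite /h mulr0 oppr0 expR0 mul1r.
have c_gt0 : 0 < c by rewrite lt_neqAle eq_sym c_neq0.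
have cT' : 0 < c <= T by rewrite c_gt0.
have slope : al * `|e c| <= `|e' c|.
  have cvg_slope : `|(s - c)^-1 *: (e s - e c)| @[s --> c^'-] --> `|e' c|.
    by apply: cvg_norm => A /(de c cT') /= /(within_itv_at_left cT').
  have cvg_weight : 1 + al * (c - s) @[s --> c^'-] --> (1 : R).
    rewrite -[X in _ --> X]addr0 -(mulr0 al) -(subrr c).
    apply: cvgD; first exact: cvg_cst.
    apply: cvgMr; apply: cvgB; first exact: cvg_cst.
    exact: cvg_at_left_filter.
  rewrite -[leRHS]mul1r; apply: (cvgr_to_ge (cvgM cvg_weight cvg_slope)).
  (* 1 + al (c - s) <= exp(al (c - s)) replaces the exponential by a factor
     for which the quotient by c - s is explicit. *)
  near=> s.
  have sc : s < c by near: s; exact: nbhs_left_lt.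
  have s0 : 0 < s by near: s; exact: nbhs_left_gt.
  have hs : h s <= h c by apply: hmax; rewrite in_itv/= ltW//= (le_trans (ltW sc)).
  pose w := al * (c - s).
  have w0 : 0 <= w by rewrite mulr_ge0 ?subr_ge0 ?ltW.
  have es : (1 + w) * `|e s| <= `|e c|.
    apply: (@le_trans _ _ (expR w * `|e s|)).
      by rewrite ler_wpM2r// expR_ge1Dx.
    rewrite -(ler_pM2l (expR_gt0 (- (al * c)))) mulrA -expRD.
    by rewrite /w mulrBr addrA addNr add0r.
  rewrite /= -/w normrZ normfV ltr0_norm ?subr_lt0// opprB.
  rewrite mulrCA ler_pdivlMl ?subr_gt0// mulrA [(c - s) * al]mulrC -/w.
  have dist : `|e c| - `|e s| <= `|e s - e c|.
    by rewrite distrC; exact: lerB_dist.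
  apply: (@le_trans _ _ ((1 + w) * (`|e c| - `|e s|))); last first.
    by rewrite ler_wpM2l// addr_ge0.
  by rewrite mulrBr lerBrDr [leRHS]mulrDl mul1r addrC lerD2r.
have ec : (al - K) * `|e c| <= (al - K) * (D * expR (al * c)).
  by rewrite mulrBl lerBlDl mulrA; exact: le_trans slope (e'le c cT').
move: ec; rewrite ler_pM2l ?subr_gt0// => ec.
by rewrite /h expRN mulrC ler_pdivrMr ?expR_gt0.
Unshelve. all: by end_near. Qed.

(** * Antiderivatives of continuous curves *)

Lemma is_derive_slope (R : realType) (V : normedModType R) (t : R)
    (u : R -> V) (du : V) (A : set R) : is_derive t 1 u du ->
  (s - t)^-1 *: (u s - u t) @[s --> within A t^'] --> du.
Proof.
move=> dut; apply: cvg_within_filter.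
have shift0 : s - t @[s --> t^'] --> 0^'.
  move=> B [e /= e0 eB]; exists e => //= s ste s_neq_t.
  by apply: eB; [rewrite /= add0r opprB|rewrite subr_eq0].
have quot : h^-1 *: (u (h *: 1 + t) - u t) @[h --> 0^'] --> du.
  by rewrite -(@derive_val _ _ _ _ _ _ _ dut); exact: ex_derive.
have := cvg_comp _ _ shift0 quot.
apply: cvg_trans; apply: near_eq_cvg; near=> s => /=.
by rewrite [X in u X](_ : _ = s)// [_ *: _]mulr1 subrK.
Unshelve. all: by end_near. Qed.

Lemma is_derive_continuous (R : realType) (V : normedModType R) (t : R)
  (u : R -> V) (du : V) : is_derive t 1 u du -> {for t, continuous u}.
Proof.
move=> dut; apply: differentiable_continuous.
exact/derivable1_diffP/(@ex_derive _ _ _ _ _ _ _ dut).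
Qed.

(** The integral starts at -1 and is taken inside [-1, T + 1], so that 0 and T
    are interior points and the derivatives there are two-sided. *)
Lemma antiderivative (R : realType) (N : nat) (T : R) (x0 : 'rV[R]_N)
    (g : R -> 'rV[R]_N) : continuous g ->
  exists G : R -> 'rV[R]_N,
    G 0 = x0 /\ forall t, 0 <= t <= T -> is_derive t 1 G (g t).
Proof.
move=> cg.
pose G j t : R := (\int[lebesgue_measure]_(s in `[(-1 : R), t]) g s ord0 j)%R.
have dG t j : 0 <= t <= T -> is_derive t 1 (G j) (g t ord0 j).
  move=> /andP[t0 tT].
  have cgj : continuous (fun s => g s ord0 j).
    move=> s; apply: (@continuous_comp _ _ _ g (fun v : 'rV[R]_N => v ord0 j)).
      exact: cg.
    exact: coord_continuous.
  have [||||dGj <-] :=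
      @continuous_FTC1_closed R (fun s => g s ord0 j) (-1) t (T + 1).
  - by rewrite (le_lt_trans tT)// ltrDl.
  - apply: continuous_compact_integrable; first exact: segment_compact.
    exact: continuous_subspaceT.
  - by rewrite (lt_le_trans _ t0)// ltrN10.
  - exact: cgj.
  by rewrite derive1E; exact: derivableP.
exists (fun t => x0 + (\row_j G j t - \row_j G j 0)).
split=> [|t tT]; first by rewrite subrr addr0.
suff dGv : is_derive t 1 (fun t => \row_j G j t : 'rV[R]_N) (g t).
  by rewrite -[g t]add0r -[g t]subr0; apply: is_deriveD; apply: is_deriveB.
have dGt : derivable (fun t => \row_j G j t) t 1.
  apply/derivable_mxP => i j; under eq_fun do rewrite mxE.
  exact: (@ex_derive _ _ _ _ _ _ _ (dG t j tT)).
apply: DeriveDef => //; rewrite derive_mx//; apply/rowP => j; rewrite mxE.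
under eq_fun do rewrite mxE.
exact: (@derive_val _ _ _ _ _ _ _ (dG t j tT)).
Qed.

(** * Global existence for a Lipschitz vector field *)

Lemma geometric_uniform_limit (R : realType) (N : nat)
    (u : nat -> R -> 'rV[R]_N) (C : R) : (forall k, continuous (u k)) ->
    (forall k m t, `|u (k + m)%N t - u k t| <= C * 2^-1 ^+ k) ->
  exists2 v : R -> 'rV[R]_N, continuous v &
    forall k t, `|v t - u k t| <= C * 2^-1 ^+ k.
Proof.
move=> cu uC.
have C0 : C * 2^-1 ^+ k @[k --> \oo] --> (0 : R).
  by apply: cvg_geometric; rewrite ger0_norm ?invr_ge0// invf_lt1// ltr1n.
have smallC e : 0 < e -> \forall k \near \oo, C * 2^-1 ^+ k < e.
  by move=> e0; exact: (cvgr_lt _ C0).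
have cvgu t : cvgn (u ^~ t).
  apply/cauchy_cvgP/cauchy_exP => e e0.
  have [k _ kC] := smallC e e0.
  exists (u k t); exists k => //= m /= km.
  rewrite -ball_normE /= distrC -(subnKC km).
  by rewrite (le_lt_trans (uC k _ t))// kC /=.
have vC k t : `|limn (u ^~ t) - u k t| <= C * 2^-1 ^+ k.
  have : `|u m t - u k t| @[m --> \oo] --> `|limn (u ^~ t) - u k t|.
    by apply: cvg_norm; apply: cvgB; [exact: cvgu|exact: cvg_cst].
  move=> /cvgr_to_le; apply; exists k => //= m /= km.
  by rewrite -(subnKC km).
exists (fun t => limn (u ^~ t)) => // t.
apply/cvgrPdist_lt => e e0.
have e3 : 0 < e / 3 by rewrite divr_gt0.
have [k _ /(_ k (leqnn k)) kC] := smallC _ e3.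
near=> s.
have us : `|u k t - u k s| < e / 3.
  by near: s; move/cvgrPdist_lt : (cu k t); exact.
rewrite (_ : limn (u ^~ t) - _ = (limn (u ^~ t) - u k t) + (u k t - u k s)
    - (limn (u ^~ s) - u k s)); last first.
  by rewrite opprB !subrKA.
rewrite (le_lt_trans (ler_normB _ _))// (_ : e = e / 3 + e / 3 + e / 3); last by lra.
rewrite ltrD ?(le_lt_trans (vC _ _))// (le_lt_trans (ler_normD _ _))// ltrD//.
by rewrite (le_lt_trans (vC _ _)).
Unshelve. all: by end_near. Qed.

Lemma dist_bound_continuous (R : realType) (V W : normedModType R) (L : R)
    (f : V -> W) : 0 < L -> (forall x y, `|f x - f y| <= L * `|x - y|) ->
  continuous f.
Proof.
move=> L0 fL x; apply/cvgrPdist_lt => e e0; near=> y.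
rewrite (le_lt_trans (fL _ _))// mulrC -ltr_pdivlMr//.
by near: y; apply: cvgr_dist_lt => //; rewrite divr_gt0.
Unshelve. all: by end_near. Qed.

(** One Picard step halves distances measured with the weight exp(2 L t): the
    derivative of w1 - w2 is at most L D exp(2 L t), whose primitive is
    (D / 2) exp(2 L t) up to a constant. *)
Lemma picard_contraction (R : realType) (N : nat) (T L D : R)
    (f : 'rV[R]_N -> 'rV[R]_N) (v1 v2 w1 w2 : R -> 'rV[R]_N) :
    0 < L -> (forall x y, `|f x - f y| <= L * `|x - y|) ->
    (forall t, 0 <= t <= T -> is_derive t 1 w1 (f (v1 t))) ->
    (forall t, 0 <= t <= T -> is_derive t 1 w2 (f (v2 t))) ->
    w1 0 = w2 0 -> 0 <= D ->
    (forall t, 0 <= t <= T -> `|v1 t - v2 t| <= D * expR (2 * L * t)) ->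
  forall t, 0 <= t <= T -> `|w1 t - w2 t| <= D * 2^-1 * expR (2 * L * t).
Proof.
move=> L_gt0 f_lip dw1 dw2 w12 D0 v12.
have de t : 0 <= t <= T -> is_derive t 1 (w1 - w2) (f (v1 t) - f (v2 t)).
  by move=> tT; apply: is_deriveB; [exact: dw1|exact: dw2].
apply: (@weighted_gronwall _ _ _ 0 _ _ (w1 - w2)
  (fun t => f (v1 t) - f (v2 t))).
- by rewrite lexx/= mulr_gt0.
- apply/subspace_continuousP => t; rewrite /= in_itv/= => tT.
  by apply: cvg_within_filter; exact: is_derive_continuous (de t tT).
- by move=> t /andP[t0 tT]; apply: is_derive_slope; apply: de; rewrite ltW.
- by rewrite !fctE w12 subrr normr0 divr_ge0.
- move=> t /andP[t0 tT]; rewrite mul0r add0r subr0.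
  have := v12 t; rewrite (ltW t0) tT => /(_ isT) v12t.
  rewrite (le_trans (f_lip _ _))//.
  rewrite (_ : _ * expR _ = L * (D * expR (2 * L * t))) ?ler_pM2l//.
  by field.
Qed.

(** The Picard iterates u_(k+1) = x0 + int_0 f(u_k) form a geometric series in
    the weighted norm and converge to a continuous v. The derivative of v is
    never computed as a limit: A v, the antiderivative of f o v with A v 0 = x0,
    is as close to u_(k+1) as v is, for every k, hence A v = v on [0, T]. *)
Theorem picard_lindelof (R : realType) (N : nat) (T L : R)
    (f : 'rV[R]_N -> 'rV[R]_N) (x0 : 'rV[R]_N) :
    0 <= T -> 0 < L -> (forall x y, `|f x - f y| <= L * `|x - y|) ->
  exists u : R -> 'rV[R]_N,
    u 0 = x0 /\ forall t, 0 <= t <= T -> is_derive t 1 u (f (u t)).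
Proof.
move=> T_ge0 L_gt0 f_lip.
(* Composing with the projection onto [0, T] turns the antiderivatives, which
   are controlled on [0, T] only, into functions continuous on all of R. *)
pose clamp (t : R) := Num.max 0 (Num.min t T).
have clamp_itv t : 0 <= clamp t <= T.
  by rewrite /clamp le_max lexx/= ge_max T_ge0 ge_min lexx orbT.
have clampE t : 0 <= t <= T -> clamp t = t.
  by move=> /andP[t0 tT]; rewrite /clamp (min_idPl tT) (max_idPr t0).
have clamp_cont : continuous clamp.
  move=> t; apply: (@continuous_max _ _ (cst 0) (fun s => Num.min s T)).
    exact: cvg_cst.
  by apply: (@continuous_min _ _ id (cst T)); [exact: cvg_id|exact: cvg_cst].
have [A A_spec] : exists A : (R -> 'rV[R]_N) -> R -> 'rV[R]_N,
    forall v, continuous v ->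
      A v 0 = x0 /\ forall t, 0 <= t <= T -> is_derive t 1 (A v) (f (v t)).
  suff /choice[A] : forall v : R -> 'rV[R]_N, exists w : R -> 'rV[R]_N,
      continuous v ->
      w 0 = x0 /\ forall t, 0 <= t <= T -> is_derive t 1 w (f (v t)) by exists A.
  move=> v; have [cv|ncv] := pselect (continuous v); last by exists v => /ncv.
  have [|w dw] := @antiderivative R N T x0 (f \o v); last by exists w.
  move=> t; apply: continuous_comp; first exact: cv.
  exact: (dist_bound_continuous L_gt0 f_lip).
pose u := fix u k : R -> 'rV[R]_N :=
  if k is j.+1 then A (u j) \o clamp else cst x0.
have cu k : continuous (u k).
  elim: k => [|k cuk]; first by move=> t; exact: cvg_cst.
  move=> t; apply: continuous_comp; first exact: clamp_cont.
  exact: is_derive_continuous ((A_spec _ cuk).2 _ (clamp_itv t)).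
have uA k t : 0 <= t <= T -> u k.+1 t = A (u k) t by move=> /clampE /= ->.
have u_clamp k t : u k (clamp t) = u k t.
  by case: k => //= k; rewrite clampE.
pose E := expR (2 * L * T).
have E_max t : 0 <= t <= T -> expR (2 * L * t) <= E.
  by move=> /andP[_ tT]; rewrite ler_expR ler_pM2l// mulr_gt0.
have exp_ge1 t : 0 <= t <= T -> 1 <= expR (2 * L * t).
  by move=> /andP[t0 _]; rewrite -expR0 ler_expR !mulr_ge0// ltW.
have [D D0 u10] : exists2 D, 0 <= D & forall t, 0 <= t <= T ->
    `|u 1%N t - u 0%N t| <= D * expR (2 * L * t).
  have [|c _ cmax] := @EVT_max R (fun t => `|u 1%N t - u 0%N t|) 0 T T_ge0.
    apply: continuous_subspaceT => t; apply: cvg_norm.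
    by apply: cvgB; exact: cu.
  exists `|u 1%N c - u 0%N c| => // t tT.
  rewrite (le_trans (cmax t _)) ?in_itv//.
  by rewrite ler_peMr// exp_ge1.
have uS k : forall t, 0 <= t <= T ->
    `|u k.+1 t - u k t| <= D * 2^-1 ^+ k * expR (2 * L * t).
  elim: k => [|k ih] t tT; first by rewrite expr0 mulr1 u10.
  rewrite !uA// exprSr mulrA; apply: (picard_contraction L_gt0 f_lip) ih t tT.
  - exact: (A_spec _ (cu k.+1)).2.
  - exact: (A_spec _ (cu k)).2.
  - by rewrite (A_spec _ (cu k.+1)).1 (A_spec _ (cu k)).1.
  - by rewrite mulr_ge0// exprn_ge0// invr_ge0.
have um k m t : 0 <= t <= T ->
    `|u (k + m)%N t - u k t| <= D * 2 * 2^-1 ^+ k * expR (2 * L * t).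
  move=> tT; elim: m k => [|m ih] k.
    by rewrite addn0 subrr normr0 !mulr_ge0 ?expR_ge0 ?exprn_ge0 ?invr_ge0.
  rewrite addnS -addSn -(subrKA (u k.+1 t)) (le_trans (ler_normD _ _))//.
  rewrite (le_trans (lerD (ih k.+1) (uS k t tT)))// exprSr -mulrDl.
  by rewrite ler_wpM2r ?expR_ge0//; lra.
have [k m t|v cv uv] := @geometric_uniform_limit R N u (D * 2 * E) cu.
  rewrite -(u_clamp (k + m)%N) -(u_clamp k) (le_trans (um k m _ (clamp_itv t)))//.
  rewrite [leRHS]mulrAC ler_wpM2l ?E_max//.
  by rewrite !mulr_ge0 ?exprn_ge0 ?invr_ge0.
have [Av0 dAv] := A_spec v cv.
have AvE t : 0 <= t <= T -> A v t = v t.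
  move=> tT; apply/eqP; rewrite -subr_eq0 -normr_le0.
  have : D * 2 * E * (E + 1) * 2^-1 ^+ k @[k --> \oo] --> (0 : R).
    by apply: cvg_geometric; rewrite ger0_norm ?invr_ge0// invf_lt1// ltr1n.
  move=> /cvgr_to_ge; apply; apply: nearW => k.
  have Ck0 : 0 <= D * 2 * E * 2^-1 ^+ k.
    by rewrite !mulr_ge0 ?expR_ge0 ?exprn_ge0 ?invr_ge0.
  have AvS : `|A v t - u k.+1 t| <=
      D * 2 * E * 2^-1 ^+ k * 2^-1 * expR (2 * L * t).
    rewrite uA//; apply: (picard_contraction (v1 := v) (v2 := u k) L_gt0 f_lip) tT => //.
    - exact: (A_spec _ (cu k)).2.
    - by rewrite (A_spec _ (cu k)).1.
    - by move=> s sT; rewrite (le_trans (uv k s))// ler_peMr// exp_ge1.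
  rewrite -(subrKA (u k.+1 t)) (le_trans (ler_normD _ _))//.
  rewrite (_ : D * 2 * E * (E + 1) * 2^-1 ^+ k =
    D * 2 * E * 2^-1 ^+ k * E + D * 2 * E * 2^-1 ^+ k); last by ring.
  apply: lerD.
    rewrite (le_trans AvS)// -mulrA ler_wpM2l//.
    by rewrite (le_trans _ (E_max t tT))// ler_piMl ?expR_ge0// invf_le1// ler1n.
  by rewrite distrC (le_trans (uv _ _))// exprS mulrCA ler_piMl// invf_le1// ler1n.
by exists (A v); split => // t tT; rewrite AvE//; exact: dAv.
Qed.

(** * Bounds on norms and derivatives *)

(** The constant of a Lipschitz map may be negative when the source space is
    trivial; a positive one is always available. *)
Lemma lipschitz_bound (R : realType) (V W : normedModType R) (L : R)
    (f : V -> W) : L.-lipschitz f ->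
  exists2 K, 0 < K & forall x y, `|f x - f y| <= K * `|x - y|.
Proof.
move=> fL; exists (`|L| + 1) => [|x y]; first by rewrite ltr_wpDl.
have /= /le_trans := fL (x, y) (conj I I); apply.
by rewrite ler_wpM2r// (le_trans (ler_norm L))// lerDl.
Qed.

(** On the empty set the supremum is -oo, which is why M is chosen
    nonnegative separately. *)
Lemma ereal_sup_bound (R : realType) (T : Type) (A : set T) (g : T -> R) :
  (ereal_sup [set (g x)%:E | x in A] < +oo)%E ->
  exists2 M, 0 <= M & forall x, A x -> g x <= M.
Proof.
move=> supA; have [[a Aa]|A0] := pselect (A !=set0); last first.
  by exists 0 => // x Ax; exfalso; apply: A0; exists x.
have le_sup x : A x -> ((g x)%:E <= ereal_sup [set (g x)%:E | x in A])%E.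
  by move=> Ax; apply: ereal_sup_ubound; exists x.
move: supA le_sup; case: ereal_sup => [M|//|] _ le_sup; last first.
  by have := le_sup a Aa.
exists `|M| => // x /le_sup; rewrite lee_fin => /le_trans; apply.
exact: ler_norm.
Qed.

(** The norms are maxima of entries, so the product sums m terms and the factor
    m cannot be dropped. *)
Lemma normr_mulmx_row (R : realType) (m n : nat) (v : 'rV[R]_m)
  (A : 'M[R]_(m, n)) : `|v *m A| <= m%:R * (`|v| * `|A|).
Proof.
have coef p q (B : 'M[R]_(p, q)) i j : `|B i j| <= `|B|.
  rewrite [leRHS]/Num.norm/= mx_normrE; exact: (le_bigmax _ _ (i, j)).
rewrite [leLHS]/Num.norm/= mx_normrE; apply: bigmax_le => [|[i j] _].
  by rewrite !mulr_ge0.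
rewrite mxE (le_trans (ler_norm_sum _ _ _))//.
rewrite -[X in X%:R]card_ord -sumr_const mulr_suml.
by apply: ler_sum => k _; rewrite mul1r normrM ler_pM.
Qed.

(** A directional derivative is a limit of difference quotients, each bounded
    by K |v|; unlike [normr_mulmx_row], this costs no dimensional factor, and it
    holds at every point, not only on the solution manifold. *)
Lemma normr_mulmx_jacobian (R : realType) (m n : nat) (K : R)
    (g : 'rV[R]_m -> 'rV[R]_n) (x v : 'rV[R]_m) :
    (forall x y, `|g x - g y| <= K * `|x - y|) -> differentiable g x ->
  `|v *m 'J g x| <= K * `|v|.
Proof.
move=> gK dg; rewrite -deriveEjacobian//.
have /cvg_norm : h^-1 *: (g (h *: v + x) - g x) @[h --> 0^'] --> 'D_v g x.
  exact: diff_derivable.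
move=> /cvgr_to_le; apply; near=> h.
have h0 : h != 0 by near: h; exact: nbhs_dnbhs_neq.
rewrite normrZ normfV ler_pdivrMl ?normr_gt0// (le_trans (gK _ _))//.
by rewrite addrK normrZ mulrCA.
Unshelve. all: by end_near. Qed.

(** * Solutions of initial value problems *)

Lemma is_derive_jacobian (R : realType) (m n : nat) (t : R)
    (u : R -> 'rV[R]_m) (du : 'rV[R]_m) (g : 'rV[R]_m -> 'rV[R]_n) :
    is_derive t 1 u du -> differentiable g (u t) ->
  is_derive t 1 (g \o u) (du *m 'J g (u t)).
Proof.
move=> dut dg.
have du_t : differentiable u t.
  exact/derivable1_diffP/(@ex_derive _ _ _ _ _ _ _ dut).
have dgu := differentiable_comp du_t dg.
apply: DeriveDef; first exact/derivable1_diffP.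
rewrite deriveE// diff_comp//= -deriveE// deriveEjacobian// -deriveE//.
by rewrite (@derive_val _ _ _ _ _ _ _ dut).
Qed.

Lemma ivp_solution_is_derive (R : realType) (m : nat) (T : R)
    (f : R -> 'rV[R]_m -> 'rV[R]_m) (x0 : 'rV[R]_m) (u : R -> 'rV[R]_m) :
    u 0 = x0 -> (forall t, 0 <= t <= T -> is_derive t 1 u (f t (u t))) ->
  ivp_solution T f x0 u.
Proof.
move=> u0 du; split=> // [|t /andP[t0 tT]]; last first.
  by apply: is_derive_slope; apply: du; rewrite ltW.
apply/subspace_continuousP => t; rewrite /= in_itv/= => tT.
by apply: cvg_within_filter; exact: is_derive_continuous (du t tT).
Qed.

(** The Lipschitz estimate is required only with one argument on the reference
    trajectory u: the difference quotients of z - u tend to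
    f(z) + d - f(u), of norm at most K |z - u| + eps. *)
Lemma ivp_stability (R : realType) (m : nat) (T K eps : R)
    (f : 'rV[R]_m -> 'rV[R]_m) (x0 d0 : 'rV[R]_m) (u z d : R -> 'rV[R]_m) :
    0 <= K ->
    (forall t x, 0 <= t <= T -> `|f x - f (u t)| <= K * `|x - u t|) ->
    ivp_solution T (fun _ => f) x0 u ->
    `|d0| <= eps -> (forall t, 0 <= t <= T -> `|d t| <= eps) ->
    ivp_solution T (fun t x => f x + d t) (x0 + d0) z ->
  forall t, 0 <= t <= T -> `|z t - u t| <= eps * expR ((K + 1) * t).
Proof.
move=> K0 fK [u_0 cu du] d0_eps d_eps [z_0 cz dz].
apply: (@weighted_gronwall _ _ T K (K + 1) eps (z - u)
  (fun t => f (z t) + d t - f (u t))).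
- by rewrite K0/= ltrDl.
- by move=> t; apply: cvgB; [exact: cz|exact: cu].
- move=> t tT.
  rewrite (_ : (fun s => _) = fun s => (s - t)^-1 *: (z s - z t) -
      (s - t)^-1 *: (u s - u t)).
    by apply: cvgB; [exact: dz|exact: du].
  apply/funext => s; rewrite -scalerBr; congr (_ *: _).
  by rewrite !fctE !opprB addrACA [- u s + _]addrC addrACA.
- by rewrite !fctE z_0 u_0 addrC addKr.
- move=> t /andP[t0 tT]; have tT' : 0 <= t <= T by rewrite ltW.
  rewrite addrAC (le_trans (ler_normD _ _))// lerD ?fK//.
  rewrite addrAC subrr add0r mul1r (le_trans (d_eps t tT'))//.
  rewrite ler_peMr ?(le_trans _ d0_eps)// -expR0 ler_expR mulr_ge0//.
    by rewrite addr_ge0.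
  by rewrite ltW.
Qed.

(** * Well-posedness of the reduced problem *)

(** The estimate is uniform in x although F is bounded only at Psi y: in the
    product rule, F(Psi y) multiplies the increment of the Jacobian, and the
    increment of F multiplies the Jacobian at Psi x, which the Lipschitz
    constant of Psi' bounds. *)
Lemma reduced_rhs_lipschitz_at (R : realType) (N n : nat)
    (K' K KF KJ M : R) (Psi' : 'rV[R]_N -> 'rV[R]_n)
    (Psi : 'rV[R]_n -> 'rV[R]_N) (F : 'rV[R]_N -> 'rV[R]_N)
    (x y : 'rV[R]_n) :
    0 <= K' -> 0 <= KF -> 0 <= KJ -> 0 <= M ->
    (forall v w, `|Psi' v - Psi' w| <= K' * `|v - w|) ->
    (forall v w, `|Psi v - Psi w| <= K * `|v - w|) ->
    (forall v w, `|F v - F w| <= KF * `|v - w|) ->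
    (forall v w, `|'J Psi' v - 'J Psi' w| <= KJ * `|v - w|) ->
    differentiable Psi' (Psi x) -> `|F (Psi y)| <= M ->
  `|reduced_rhs Psi' Psi F x - reduced_rhs Psi' Psi F y| <=
    (K' * KF * K + N%:R * M * KJ * K) * `|x - y|.
Proof.
move=> K'0 KF0 KJ0 M0 Psi'K PsiK FK JK dPsi' FM.
rewrite /reduced_rhs.
rewrite (_ : _ - _ = (F (Psi x) - F (Psi y)) *m 'J Psi' (Psi x) +
    F (Psi y) *m ('J Psi' (Psi x) - 'J Psi' (Psi y))); last first.
  by rewrite mulmxBl mulmxBr subrKA.
rewrite (le_trans (ler_normD _ _))// mulrDl lerD//.
  rewrite (le_trans (normr_mulmx_jacobian _ Psi'K dPsi'))// -!mulrA ler_wpM2l//.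
  by rewrite (le_trans (FK _ _))// ler_wpM2l.
rewrite (le_trans (normr_mulmx_row _ _))// -!mulrA ler_wpM2l//.
rewrite ler_pM// (le_trans (JK _ _))// ler_wpM2l//.
Qed.

Theorem theorem5 (R : realType) (a N n : nat) (P : set 'rV[R]_a.-1) (T : R)
    (F : 'rV[R]_N -> 'rV[R]_a.-1 -> 'rV[R]_N) (u0 : 'rV[R]_a.-1 -> 'rV[R]_N)
    (Psi' : 'rV[R]_N -> 'rV[R]_n) (Psi : 'rV[R]_n -> 'rV[R]_N)
    (L_Psi' L_Psi L_J : R) (L_F : 'rV[R]_a.-1 -> R)
    (n_lt_N : (n < N)%N)
    (P_compact : compact P)
    (P_interior : P° !=set0)
    (T_gt0 : 0 < T)
    (PsiK : forall u, solution_manifold P T F u0 u -> Psi (Psi' u) = u)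
    (Psi'_lip : L_Psi'.-lipschitz Psi')
    (Psi_lip : L_Psi.-lipschitz Psi)
    (F_lip : forall mu, P mu -> (L_F mu).-lipschitz (fun u => F u mu))
    (Psi'_diff : forall u, differentiable Psi' u)
    (J_lip : L_J.-lipschitz (fun u => 'J Psi' u))
    (J_bounded : (ereal_sup [set (`|'J Psi' u|)%:E
                            | u in solution_manifold P T F u0] < +oo)%E)
    (F_bounded : forall mu, P mu ->
       (ereal_sup [set (`|F u mu|)%:E
                  | u in solution_manifold P T F u0] < +oo)%E) :
  forall mu, P mu ->
    well_posed T Psi (reduced_rhs Psi' Psi (fun u => F u mu)) (Psi' (u0 mu)).
Proof.
move=> mu Pmu.
have [K' K'0 Psi'K] := lipschitz_bound Psi'_lip.
have [K K0 PsiL] := lipschitz_bound Psi_lip.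
have [KF KF0 FK] := lipschitz_bound (F_lip mu Pmu).
have [KJ KJ0 JK] := lipschitz_bound J_lip.
have [M M0 FM] := ereal_sup_bound (F_bounded mu Pmu).
set f := reduced_rhs _ _ _.
have [w [w0 dw]] := picard_lindelof (u0 mu) (ltW T_gt0) KF0 FK.
have w_sol : ivp_solution T (fun _ x => F x mu) (u0 mu) w.
  exact: ivp_solution_is_derive.
have w_manifold t : 0 <= t <= T -> solution_manifold P T F u0 (w t).
  by move=> tT; exists mu, w, t.
have Psi_ref t : 0 <= t <= T -> Psi (Psi' (w t)) = w t.
  by move=> /w_manifold; exact: PsiK.
have ref_sol : ivp_solution T (fun=> f) (Psi' (u0 mu)) (Psi' \o w).
  apply: ivp_solution_is_derive => [|t tT]; first by rewrite /= w0.
  rewrite /f /reduced_rhs /= Psi_ref//.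
  by apply: is_derive_jacobian => //; exact: dw.
pose Kf := K' * KF * K + N%:R * M * KJ * K.
have Kf0 : 0 <= Kf by rewrite addr_ge0// !mulr_ge0// ltW.
have f_ref t x : 0 <= t <= T ->
    `|f x - f ((Psi' \o w) t)| <= Kf * `|x - (Psi' \o w) t|.
  move=> tT; apply: reduced_rhs_lipschitz_at => //; try exact: ltW.
  by rewrite /= Psi_ref//; apply: FM; exact: w_manifold.
(* Every exact or perturbed solution is compared with Psi' o w. *)
have stable := ivp_stability Kf0 f_ref ref_sol.
have unique un : ivp_solution T (fun=> f) (Psi' (u0 mu)) un ->
    forall t, 0 <= t <= T -> un t = Psi' (w t).
  move=> un_sol t tT; apply/eqP; rewrite -subr_eq0 -normr_le0.
  rewrite -(mul0r (expR ((Kf + 1) * t))).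
  apply: (@stable 0 0 un (fun=> 0)) => [|s _||//]; rewrite ?normr0// addr0.
  rewrite (_ : (fun _ x => _) = fun=> f)//.
  by apply/funext => s; apply/funext => x; rewrite addr0.
split.
- by exists (Psi \o (Psi' \o w)), (Psi' \o w).
- move=> uN un vN vn [uNE un_sol] [vNE vn_sol] t tT.
  by rewrite uNE// vNE// (unique un)// (unique vn).
(* The factor 1 + K covers both un (factor 1) and uN = Psi un (factor K). *)
exists ((1 + K) * expR ((Kf + 1) * T)).
  by rewrite mulr_gt0 ?expR_gt0// ltr_wpDl// ltW.
move=> uN un [uNE un_sol] eps d0 d zN zn d0_eps d_eps [zNE zn_sol] t tT.
have eps0 : 0 <= eps by exact: le_trans d0_eps.
have zn_un : `|zn t - un t| <= expR ((Kf + 1) * T) * eps.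
  rewrite (unique un)// mulrC (le_trans (stable _ _ _ _ d0_eps d_eps zn_sol t tT))//.
  rewrite ler_wpM2l// ler_expR ler_wpM2l//; first by rewrite addr_ge0.
  by case/andP: tT.
have E0 : 0 <= expR ((Kf + 1) * T) * eps by rewrite mulr_ge0// expR_ge0.
rewrite -mulrA mulrDl mul1r; split.
  rewrite zNE// uNE// (le_trans (PsiL _ _))// (le_trans (ler_wpM2l (ltW K0) zn_un))//.
  by rewrite lerDr.
by rewrite (le_trans zn_un)// lerDl mulr_ge0// ltW.
Qed.
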